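(* Let $\Omega$ be a nonempty open subset of $\mathbb{C}$. Let $\mathcal{S}_{uc}$ be the set of sequences $(f_n)\in H(\Omega)^{\mathbb{N}}$ that converge to $0$ uniformly on every compact subset of $\Omega$, and let $\mathcal{S}_u$ be the set of sequences $(f_n)\in H(\Omega)^{\mathbb{N}}$ that converge to $0$ uniformly on $\Omega$. Then the set $\mathcal{S}_{uc}\setminus\mathcal{S}_u$ is strongly $\mathfrak{c}$-algebrable (as a subset of the commutative algebra $H(\Omega)^{\mathbb{N}}$).
   Context: $H(\Omega)$ is the complex vector space of all holomorphic functions on $\Omega$ (which is not assumed connected). $H(\Omega)^{\mathbb{N}}$ is the set of all sequences of holomorphic functions on $\Omega$; with termwise sum, termwise multiplication by complex scalars, and termwise product $(f_n)\cdot(g_n)=(f_n g_n)$ it is a commutative complex algebra. $\mathfrak{c}$ is the cardinality of the continuum. For a cardinal $\alpha$, a subset $A$ of a commutative complex algebra is called strongly $\alpha$-algebrable if there is an $\alpha$-generated free algebra $\mathcal{M}$ with $\mathcal{M}\setminus\{0\}\subset A$; that is, there is a subset $B$ of the algebra, of cardinality $\alpha$, such that for every positive integer $N$, every nonzero complex polynomial $P$ in $N$ variables without constant term, and all distinct elements $z_1,\ldots,z_N\in B$, one has $P(z_1,\ldots,z_N)\in A\setminus\{0\}$. *)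

(* Defs.v *)
From HB Require Import structures.
From mathcomp Require Import all_boot all_order all_algebra.
From mathcomp Require Import all_classical all_reals all_analysis.
From mathcomp Require Import -(notations) complex.
From mathcomp Require Import -(notations) mpoly.

Set Implicit Arguments.
Unset Strict Implicit.
Unset Printing Implicit Defensive.
Import Order.TTheory GRing.Theory Num.Theory.
Import numFieldNormedType.Exports.
Local Open Scope classical_set_scope.
Local Open Scope ring_scope.

(* An alias, because complex R is already a left module over R, whereas here the
   complex numbers are to be a normed module over themselves, so that derivable
   means complex differentiable. *)
Definition C (R : realType) : Type := complex R.

Section complex_instances.
Context (R : realType).
HB.instance Definition _ := Num.ClosedField.copy (C R) (complex R).
#[non_forgetful_inheritance]
HB.instance Definition _ := GRing.ComAlgebra.copy (C R) (C R)^o.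
#[non_forgetful_inheritance]
HB.instance Definition _ := Vector.copy (C R) (C R)^o.
#[non_forgetful_inheritance]
HB.instance Definition _ := NormedModule.copy (C R) (C R)^o.
HB.instance Definition _ := Num.ClosedField.on (C R).
End complex_instances.

HB.instance Definition _ (T : pointedType) (K : pzRingType) (A : comAlgType K) :=
  GRing.Lmodule_isLalgebra.Build K (T -> A)
    (fun a f g => funext (fun x => scalerAl a (f x) (g x))).
HB.instance Definition _ (T : pointedType) (K : pzRingType) (A : comAlgType K) :=
  GRing.Lalgebra_isComAlgebra.Build K (T -> A).

(* alpha stands for the cardinality of that type. *)
Definition strongly_algebrable (alpha : Type) (K : fieldType) (A : comAlgType K)
    (S : set A) : Prop :=
  exists2 B : set A, (B #= [set: alpha])%card &
    forall (N : nat) (P : mpoly N K) (z : 'I_N -> A),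
      (0 < N)%N -> P != 0 -> mcoeff mnm0 P = 0 ->
      injective z -> (forall i, B (z i)) ->
      (S `\ 0) (mmap (in_alg A) z P).

Section holomorphic_functions.
Context {R : realType} (Omega : set (C R)).

(* Extension by zero to the whole plane; only its values on Omega matter below,
   since Omega is open. *)
Definition ext0 (f : Omega -> C R) : C R -> C R := 'valL_0 f.

Lemma ext0_in (f : Omega -> C R) (z : Omega) : ext0 f (set_val z) = f z.
Proof. exact: (congr1 (@^~ z) (valLK 0 f)). Qed.

Definition holomorphic (f : Omega -> C R) : Prop :=
  forall z, Omega z -> derivable (ext0 f) z 1.

Definition holomorphicb : pred (Omega -> C R) := fun f => `[< holomorphic f >].

Context (Omega_open : open Omega).

Lemma holomorphic_near (f : Omega -> C R) (g : C R -> C R) (z : C R) :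
  Omega z -> (forall w : Omega, f w = g (set_val w)) -> derivable g z 1 ->
  derivable (ext0 f) z 1.
Proof.
move=> Oz fg; apply: near_eq_derivable.
near=> w; have Ow : Omega w by near: w; exact: open_nbhs_nbhs.
by rewrite -[w in RHS]/(set_val (SigSub (mem_set Ow))) ext0_in fg.
Unshelve. all: by end_near. Qed.

Lemma holomorphicB : zmod_closed holomorphicb.
Proof.
split=> [|f g /asboolP fh /asboolP gh]; apply/asboolP => z Oz.
  by apply: (holomorphic_near (g := cst 0)) => //; exact: derivable_cst.
apply: (holomorphic_near (g := ext0 f - ext0 g)) => //.
  by move=> w; rewrite !fctE !ext0_in.
by apply: derivableB; [exact: fh | exact: gh].
Qed.

Lemma holomorphicM : mulr_closed holomorphicb.
Proof.
split=> [|f g /asboolP fh /asboolP gh]; apply/asboolP => z Oz.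
  by apply: (holomorphic_near (g := cst 1)) => //; exact: derivable_cst.
apply: (holomorphic_near (g := ext0 f * ext0 g)) => //.
  by move=> w; rewrite !fctE !ext0_in.
by apply: derivableM; [exact: fh | exact: gh].
Qed.

Lemma holomorphicZ : scaler_closed holomorphicb.
Proof.
move=> a f /asboolP fh; apply/asboolP => z Oz.
apply: (holomorphic_near (g := a *: ext0 f)) => //.
  by move=> w; rewrite !fctE !ext0_in.
by apply: derivableZ; exact: fh.
Qed.

End holomorphic_functions.

(* H(Omega). Openness makes it closed under the algebra operations (hence the
   two proofs as parameters); nonemptiness makes 1 <> 0, as comAlgType requires. *)
Record holo (R : realType) (Omega : set (C R))
    (Omega_open : open Omega) (Omega_neq0 : Omega !=set0) := Holo {
  holo_fun :> Omega -> C R;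
  _ : holomorphicb holo_fun }.
Arguments holo {R Omega} Omega_open Omega_neq0.

Section holo_algebra.
Context (R : realType) (Omega : set (C R)).
Context (Omega_open : open Omega) (Omega_neq0 : Omega !=set0).
Local Notation H := (holo Omega_open Omega_neq0).

HB.instance Definition _ := [isSub for @holo_fun R Omega Omega_open Omega_neq0].
HB.instance Definition _ := [Choice of H by <:].
HB.instance Definition _ := GRing.SubChoice_isSubZmodule.Build
  (Omega -> C R) (@holomorphicb R Omega) H (holomorphicB Omega_open).
HB.instance Definition _ := GRing.SubNmodule_isSubPzSemiRing.Build
  (Omega -> C R) (@holomorphicb R Omega) H (holomorphicM Omega_open).
HB.instance Definition _ := GRing.SubPzSemiRing_isSubComPzSemiRing.Build
  (Omega -> C R) (@holomorphicb R Omega) H.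
HB.instance Definition _ := GRing.SubZmodule_isSubLmodule.Build
  (C R) (Omega -> C R) (@holomorphicb R Omega) H
  (conj (GRing.zmod_closedD (holomorphicB Omega_open)) (holomorphicZ Omega_open)).

Lemma holo_oner_neq0 : 1 != 0 :> H.
Proof.
have [z Oz] := Omega_neq0; apply/eqP => /(congr1 (fun f : H => f (SigSub (mem_set Oz)))).
by move/eqP; rewrite oner_eq0.
Qed.
HB.instance Definition _ := GRing.PzSemiRing_isNonZero.Build H holo_oner_neq0.

Lemma holo_scalerAl (a : C R) (f g : H) : a *: (f * g) = (a *: f) * g.
Proof. by apply: val_inj; apply/funext => z; exact: mulrA. Qed.
HB.instance Definition _ := GRing.Lmodule_isLalgebra.Build (C R) H holo_scalerAl.
HB.instance Definition _ := GRing.Lalgebra_isComAlgebra.Build (C R) H.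
End holo_algebra.

Definition holo_seq (R : realType) (Omega : set (C R))
    (Omega_open : open Omega) (Omega_neq0 : Omega !=set0) : comAlgType (C R) :=
  nat -> holo Omega_open Omega_neq0.

Section convergence_to_zero.
Context (R : realType) (Omega : set (C R)).
Context (Omega_open : open Omega) (Omega_neq0 : Omega !=set0).
Local Notation HN := (holo_seq Omega_open Omega_neq0).

Definition S_uc : set HN :=
  [set f : HN | forall K : set (C R), compact K -> K `<=` Omega ->
     {uniform K, ext0 (f n) @[n --> \oo] --> (0 : C R -> C R)}].

Definition S_u : set HN :=
  [set f : HN | {uniform Omega, ext0 (f n) @[n --> \oo] --> (0 : C R -> C R)}].

End convergence_to_zero.
Arguments S_uc {R Omega} Omega_open Omega_neq0.
Arguments S_u {R Omega} Omega_open Omega_neq0.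

(* Main.v *)
(* Omega carries an unbounded holomorphic function h: the identity if Omega is
   the whole plane, and z |-> 1 / (z - a) for a boundary point a otherwise.
   Choose natural-valued sequences (a c n), indexed by the reals c and bounded
   by M n uniformly in c, which are independent: at distinct reals they take any
   prescribed tuple of values simultaneously for infinitely many n.  Choose also
   points x_n of Omega with |h (x_n)| > (n + 1) (M n + 1), and put
     G c n = a c n / h (x_n) * h.
   As |G c n| <= |h| / (n + 1), a polynomial without constant term in the G c
   tends to 0 locally uniformly.  But its value at x_n is the value of the
   polynomial at the a c n, which is a fixed nonzero number for infinitely many
   n, as a nonzero polynomial does not vanish at all tuples of naturals. *)
Require Import Defs.
From mathcomp Require Import all_boot all_order all_algebra.
From mathcomp Require Import all_classical all_reals all_analysis.
From mathcomp Require Import -(notations) complex.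
From mathcomp Require Import -(notations) mpoly.
Import Order.TTheory GRing.Theory Num.Theory.
Import numFieldNormedType.Exports.
Local Open Scope classical_set_scope.
Local Open Scope ring_scope.

Set Implicit Arguments.
Unset Strict Implicit.
Unset Printing Implicit Defensive.

(** * Independent sequences of naturals indexed by the reals *)

Lemma separating_rat_intervals (R : archiRealFieldType) (I : finType)
    (c : I -> R) (i : I) : injective c ->
  exists qr : rat * rat, forall j : I,
    (ratr qr.1 < c j < ratr qr.2) = (j == i).
Proof.
(* Rational endpoints are taken within the least distance [d] from [c i] to the other points; the
   default 1 keeps [d] positive when there are none. *)
move=> c_inj; pose d := \big[Order.min/1]_(j | j != i) `|c i - c j|.
have d_gt0 : 0 < d.
  apply: lt_bigmin => // j ji; rewrite normr_gt0 subr_eq0.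
  by apply: contra ji => /eqP/c_inj ->.
have /rat_in_itvoo[q /itvP qE] : c i - d < c i by rewrite gtrBl.
have /rat_in_itvoo[r /itvP rE] : c i < c i + d by rewrite ltrDl.
exists (q, r) => j /=; have [->|ji] := eqVneq j i; first by rewrite qE rE.
apply/negP => /andP[qj jr].
have : d <= `|c i - c j| by exact: bigmin_le_cond.
apply/negP; rewrite -ltNge distrC ltr_distl.
by rewrite (lt_trans _ qj) ?qE// (lt_trans jr) ?rE.
Qed.

Lemma injective_unbounded (f : nat -> nat) (n : nat) :
  injective f -> exists m, (n <= f m)%N.
Proof.
move=> f_inj; apply: contrapT => /forallNP fn.
have lt_fn m : (f m < n)%N by rewrite ltnNge; apply/negP.
have : injective (fun m : 'I_n.+1 => Ordinal (lt_fn m)).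
  by move=> m1 m2 /(congr1 val)/f_inj/val_inj.
by move/leq_card; rewrite !card_ord ltnn.
Qed.

(* An index n encodes a finite list of triples (q, r, k), at which a c takes as
   its value the sum of the k for which c lies in ]q, r[; an additional natural
   number in the code makes each list occur infinitely often. *)
Lemma independent_sequences (R : archiRealFieldType) :
  exists (a : R -> nat -> nat) (M : nat -> nat),
    (forall c n, (a c n <= M n)%N) /\
    forall (I : finType) (c : I -> R) (k : I -> nat) (n0 : nat), injective c ->
      exists2 n, (n0 <= n)%N & forall i, a (c i) n = k i.
Proof.
pose code := (nat * seq (rat * rat * nat))%type.
pose s n := if unpickle n is Some x then (x : code).2 else [::].
exists (fun (c : R) n =>
  (\sum_(x <- s n | (ratr x.1.1 < c < ratr x.1.2)%R) x.2)%N).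
exists (fun n => (\sum_(x <- s n) x.2)%N); split.
  by move=> c n; rewrite big_mkcond; apply: leq_sum => x _; case: ifP.
move=> I c k n0 c_inj.
have /boolp.choice[qr qrE] := fun i => separating_rat_intervals i c_inj.
pose s0 := [seq (qr i, k i) | i <- index_enum I].
(* Varying the dummy [m] gives infinitely many codes of the same list [s0], hence one beyond
   [n0]. *)
have [m n0m] := @injective_unbounded (fun m => pickle ((m, s0) : code)) n0
  (fun m1 m2 e => congr1 fst (pcan_inj (@pickleK code) e)).
exists (pickle ((m, s0) : code)) => // j.
rewrite /s pickleK /= big_map /=; under eq_bigl do rewrite qrE eq_sym.
by rewrite big_pred1_eq.
Qed.

(** * Nonzero polynomials at tuples of naturals *)

Lemma nat_nonroot (F : numFieldType) (p : {poly F}) :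
  p != 0 -> exists k : nat, ~~ root p k%:R.
Proof.
move=> p0; pose s := [seq k%:R : F | k <- iota 0 (size p)].
have s_uniq : uniq s.
  by rewrite map_inj_uniq ?iota_uniq// => x y /eqP; rewrite eqr_nat => /eqP.
have : ~~ all (root p) s.
  apply/negP => /(max_poly_roots p0)/(_ s_uniq).
  by rewrite size_map size_iota ltnn.
by rewrite all_map => /allPn[k _ pk]; exists k.
Qed.

Lemma widen_ord_lift_max (n : nat) (i : 'I_n) :
  widen_ord (leqnSn n) i = lift ord_max i.
Proof. by apply: val_inj; exact: esym (lift_max i). Qed.

(** As [muni] views [p] as a polynomial in its last variable, this recovers every coefficient of
    [p]; in particular [muni p = 0] forces [p = 0]. *)
Lemma mcoeff_muni (n : nat) (R : nzRingType) (p : mpoly n.+1 R)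
    (m : multinom n.+1) :
  mcoeff (Multinom [tuple m (widen_ord (leqnSn n) i) | i < n])
    (muni p)`_(m ord_max) = mcoeff m p.
Proof.
rewrite muniE coef_sum raddf_sum [in RHS](mpolyE p) raddf_sum /=.
apply: eq_bigr => m1 _; rewrite coefZ coefXn mcoeffZ mcoeffX mulr_natr.
rewrite mcoeffMn mcoeffZ mcoeffX -mulrnAr -mulrnA mulnb.
congr (_ * (_ : bool)%:R); apply/andP/eqP => [[/eqP/mnmP mE /eqP m_max]|->//].
apply/mnmP => i; case: (unliftP ord_max i) => [j ->|-> //].
by have := mE j; rewrite !mnmE widen_ord_lift_max.
Qed.

Lemma meval_muni (n : nat) (K : comNzRingType) (p : mpoly n.+1 K)
    (v : 'I_n.+1 -> K) :
  meval v p =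
  (map_poly (meval (fun i => v (widen_ord (leqnSn n) i))) (muni p)).[v ord_max].
Proof.
rewrite muniE mevalE rmorph_sum horner_sum; apply: eq_bigr => m _ /=.
rewrite -!mul_polyC rmorphM /= map_polyC map_polyXn hornerM hornerC hornerXn /=.
rewrite mevalZ mevalX big_ord_recr /= mulrA; congr (_ * _ * _).
by apply: eq_bigr => i _; rewrite mnmE.
Qed.

(** Induction on the number of variables: first make the leading coefficient in the last variable
    nonzero, then avoid the finitely many roots of the resulting univariate polynomial. *)
Lemma meval_nat_neq0 (n : nat) (K : numFieldType) (p : mpoly n K) :
  p != 0 -> exists k : 'I_n -> nat, meval (fun i => (k i)%:R) p != 0.
Proof.
elim: n p => [|n IHn] p p0.
  exists (fun=> 0%N); apply: contra p0 => /eqP; rewrite mevalE => pv.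
  apply/eqP/mpolyP => m; rewrite mcoeff0.
  have m0 : m = mnm0 by apply/mnmP => -[].
  have [mp|] := boolP (m \in msupp p); last exact: memN_msupp_eq0.
  rewrite -[RHS]pv (perm_big [:: m]) ?big_seq1 ?big_ord0 ?mulr1//.
  apply: uniq_perm; rewrite ?msupp_uniq// => m1; rewrite inE.
  by have -> : m1 = m; [apply/mnmP => -[] | rewrite mp eqxx].
have q0 : muni p != 0.
  apply: contra p0 => /eqP q0; apply/eqP/mpolyP => m.
  by rewrite -mcoeff_muni q0 coef0 !mcoeff0.
have [k kq] : exists k : 'I_n -> nat,
    meval (fun i => (k i)%:R) (lead_coef (muni p)) != 0.
  by apply: IHn; rewrite lead_coef_eq0.
have [|k1 k1q] := @nat_nonroot K (map_poly (meval (fun i => (k i)%:R)) (muni p)).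
  by rewrite -lead_coef_eq0 lead_coef_map_eq.
exists (fun i => oapp k k1 (unlift ord_max i)); rewrite meval_muni unlift_none /=.
rewrite (@eq_map_poly _ _ _ (meval (fun i => (k i)%:R)))// => q.
by apply: meval_eq => i; rewrite widen_ord_lift_max liftK.
Qed.

(** * Convergence, norms and connectedness in the complex plane *)

Lemma uniform_cvg0P (U : choiceType) (K : numFieldType) (V : normedModType K)
    (A : set U) (f : nat -> U -> V) :
  {uniform A, f n @[n --> \oo] --> (0 : U -> V)} <->
  forall e : K, 0 < e -> \forall n \near \oo, forall x, A x -> `|f n x| < e.
Proof.
split=> [f0 e e0|f0 P /uniform_nbhs[E [/= + EP]]].
  apply: (f0 [set g | forall x, A x -> `|g x| < e]); apply/uniform_nbhs.
  exists [set xy | ball xy.1 e xy.2]; split.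
    exact: entourage_ball (PosNum e0).
  by move=> g /= gE x /gE; rewrite -ball_normE /= sub0r normrN.
rewrite -entourage_ballE => -[e /= e0 eE].
apply: filterS (f0 e e0) => n fn; apply: EP => x /fn fx.
by apply: eE; rewrite /= -ball_normE /= sub0r normrN.
Qed.

Lemma norm_lt_nat (R : realType) (x : C R) : exists n : nat, `|x| < n%:R.
Proof.
rewrite [`|x|]normc_def; set r := Num.sqrt _; exists (Num.bound r).
suff : real_complex R r < (Num.bound r)%:R by [].
by rewrite -(rmorph_nat (real_complex R)) ltcR archi_boundP ?sqrtr_ge0.
Qed.

Lemma real_complex_continuous (R : realType) :
  continuous (real_complex R : R -> C R).
Proof.
move=> x; apply/cvgrPdist_lt => e e0.
(* A positive element of [C R] is real, so the estimate can be made in [R]. *)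
have eE : e = real_complex R (complex.Re e).
  by rewrite RRe_real// gtr0_real.
have re0 : 0 < complex.Re e by move: e0; rewrite {1}eE (ltcR 0).
near=> y.
have -> : `|(real_complex R x : C R) - real_complex R y| =
    real_complex R `|x - y|.
  by rewrite -rmorphB [LHS]normc_def /= expr0n addr0 sqrtr_sqr.
rewrite eE ltcR; near: y; exact: cvgr_dist_lt.
Unshelve. all: by end_near. Qed.

(** The preimage of [A] under a parametrized line through [a] and [b] is clopen and nonempty in the
    connected real line. *)
Lemma clopen_C (R : realType) (A : set (C R)) :
  open A -> closed A -> A !=set0 -> A = setT.
Proof.
move=> oA cA [a Aa]; apply/seteqP; split=> // b _.
pose g (t : R) : C R := a + (real_complex R t : C R) * (b - a).
have g_cont : continuous g.
  move=> t; apply: cvgD; first exact: cvg_cst.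
  apply: cvgM; first exact: real_complex_continuous.
  exact: cvg_cst.
have conn : connected [set: R] by apply/connected_intervalP.
have -> : b = g 1 by rewrite /g rmorph1 mul1r addrC subrK.
suff : g @^-1` A = setT by move=> gA; rewrite -[A _]/((g @^-1` A) 1) gA.
apply: conn.
- by exists 0; rewrite /g /= rmorph0 mul0r addr0.
- by exists (g @^-1` A); rewrite ?setTI//; apply: open_comp => //.
- by exists (g @^-1` A); rewrite ?setTI//; apply: closed_comp => //.
Qed.

Lemma exists_unbounded_holomorphic (R : realType) (A : set (C R)) :
  open A -> A !=set0 ->
  exists2 h : C R -> C R, forall z, A z -> derivable h z 1 &
    forall n : nat, exists2 z, A z & n%:R < `|h z|.
Proof.
move=> oA A0; have [->|AT] := pselect (A = setT).
  exists id => // n; exists n.+1%:R => //=; rewrite normr_nat ltr_nat //.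
have [a [cla Aa]] : exists a, closure A a /\ ~ A a.
  apply: contrapT => /forallNP clA; apply/AT/clopen_C => //.
  by move=> a cla; apply: contrapT => Aa; apply: (clA a).
have sub_neq0 z : A z -> z - a != 0.
  by move=> Az; rewrite subr_eq0; apply: contra_not_neq Aa => <-.
exists (fun z => (z - a)^-1) => [z Az|n].
  apply: derivableV; first exact: sub_neq0.
  by apply: derivableB; [exact: derivable_id | exact: derivable_cst].
(* A point of [A] at distance less than [1 / (n + 1)] from [a] has image of modulus above
   [n + 1]. *)
have [|z [Az]] := cla (ball a n.+1%:R^-1).
  by apply: nbhsx_ballx; rewrite invr_gt0.
rewrite -ball_normE /= distrC => az; exists z => //.
rewrite (@lt_trans _ _ n.+1%:R) ?ltr_nat// normfV -[ltLHS]invrK.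
by rewrite ltf_pV2 // posrE ?invr_gt0// normr_gt0 sub_neq0.
Qed.

Lemma meval_small (n : nat) (K : numFieldType) (p : mpoly n K) :
  mcoeff mnm0 p = 0 ->
  forall e : K, 0 < e -> exists2 d : K, 0 < d & forall v : 'I_n -> K,
    (forall i, `|v i| < d) -> `|meval v p| < e.
Proof.
move=> p0 e e0; pose s := \sum_(m <- msupp p) `|mcoeff m p|.
have s0 : 0 <= s by apply: sumr_ge0.
have s1 : 0 < e + s by rewrite ltr_pwDl.
(* This choice gives both [d <= 1] and [s * d < e], also when [s = 0]. *)
pose d := e / (e + s); have d0 : 0 < d by rewrite divr_gt0.
have d1 : d <= 1 by rewrite ler_pdivrMr// mul1r lerDl.
exists d => // v vd.
have : `|meval v p| <= s * d.
  rewrite mevalE (le_trans (ler_norm_sum _ _ _))// mulr_suml !big_seq.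
  apply: ler_sum => m mp; rewrite normrM ler_wpM2l// normr_prod.
  have [i mi] : exists i, m i != 0%N.
    apply: contrapT => /forallNP m0; move: mp; rewrite mcoeff_msupp.
    rewrite (_ : m = mnm0) ?p0 ?eqxx//; apply/mnmP => i; rewrite mnmE.
    by apply/eqP; rewrite -[_ == _]negbK; apply/negP/m0.
  have v1 j : `|v j| <= 1 by rewrite ltW// (lt_le_trans (vd j)).
  (* The factor of a variable that occurs is at most [d], and all others are at most 1. *)
  rewrite (bigD1 i)//= -[leRHS]mulr1 ler_pM// ?prodr_ge0//.
    by rewrite normrX (le_trans (ler_iXnr _ _ _))// ?lt0n// ltW.
  by apply: prodr_ile1 => j _; rewrite normr_ge0 normrX exprn_ile1.
move=> /le_lt_trans -> //; rewrite mulrA ltr_pdivrMr// mulrDr mulrC ltrDr.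
by rewrite mulr_gt0.
Qed.

(** * Sequences of holomorphic functions *)

Section holo_sequences.
Context (R : realType) (Omega : set (C R)).
Context (Omega_open : open Omega) (Omega_neq0 : Omega !=set0).
Local Notation HN := (holo_seq Omega_open Omega_neq0).

Lemma mmap_holo_seqE (N : nat) (P : mpoly N (C R)) (z : 'I_N -> HN)
    (n : nat) (w : Omega) :
  (mmap (in_alg HN) z P) n w = meval (fun i => z i n w) P.
Proof.
pose ev (F : HN) : C R := F n w.
have evD : {morph ev : F G / F + G} by [].
have evM : {morph ev : F G / F * G} by [].
rewrite -[LHS]/(ev _) mevalE (big_morph ev evD erefl).
apply: eq_bigr => m _; rewrite evM; congr (_ * _); first exact: mulr1.
rewrite (big_morph ev evM erefl); apply: eq_bigr => i _.
by elim: (m i) => // k IHk; rewrite !exprS evM IHk.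
Qed.

Lemma holomorphic_scale (a : C R) (h : C R -> C R) :
  (forall z, Omega z -> derivable h z 1) ->
  holomorphicb (fun w : Omega => a * h (set_val w)).
Proof.
move=> h_der; apply/asboolP => z Oz.
apply: (holomorphic_near Omega_open (g := a *: h)) => //.
by apply: derivableZ; exact: h_der.
Qed.

Lemma S_uc_locally_uniform (F : HN) :
  (forall (z : C R) (e : C R), Omega z -> 0 < e ->
     \forall z' \near z & n \near \oo, forall w : Omega, set_val w = z' ->
       `|F n w| < e) ->
  S_uc Omega_open Omega_neq0 F.
Proof.
move=> F_lu K cK KO; apply/uniform_cvg0P => e e0.
have /compact_near_coveringP cK' := cK.
(* The premise [K z'] is there because the covering property ranges over all points near [x],
   possibly outside [Omega]. *)
suff : \forall n \near \oo, K `<=` (fun z' => K z' -> `|ext0 (F n) z'| < e).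
  by apply: filterS => n Fn x Kx; exact: Fn.
apply: cK' => x /KO Ox; apply: filterS (F_lu x e Ox e0) => -[z' n] /= Fn Kz'.
have Oz' := KO _ Kz'.
by rewrite -[z']/(set_val (SigSub (mem_set Oz'))) ext0_in Fn.
Qed.

Lemma S_uP (F : HN) :
  S_u Omega_open Omega_neq0 F <->
  forall e : C R, 0 < e ->
    \forall n \near \oo, forall w : Omega, `|F n w| < e.
Proof.
apply: (iff_trans (uniform_cvg0P _ _)); split=> F0 e /F0.
  all: apply: filterS => n Fn.
  by move=> w; rewrite -ext0_in Fn//; exact: set_valP.
by move=> x Ox; rewrite -[x]/(set_val (SigSub (mem_set Ox))) ext0_in Fn.
Qed.

End holo_sequences.

Theorem theorem3p2 (R : realType) (Omega : set (C R))
    (Omega_open : open Omega) (Omega_neq0 : Omega !=set0) :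
  strongly_algebrable R (S_uc Omega_open Omega_neq0 `\` S_u Omega_open Omega_neq0).
Proof.
have [h h_der h_unb] := exists_unbounded_holomorphic Omega_open Omega_neq0.
have [a [M [aM a_indep]]] := independent_sequences R.
have /boolp.choice[x xP] : forall n, exists w : Omega,
    (n.+1 * (M n).+1)%:R < `|h (set_val w)|.
  move=> n; have [z Oz hz] := h_unb (n.+1 * (M n).+1)%N.
  by exists (SigSub (mem_set Oz)).
pose hx n := h (set_val (x n)).
have hx_gt0 n : 0 < `|hx n| by exact: le_lt_trans (xP n).
pose G c n : holo Omega_open Omega_neq0 :=
  Holo Omega_open Omega_neq0
    (holomorphic_scale Omega_open ((a c n)%:R / hx n) h_der).
have Gx c n : G c n (x n) = (a c n)%:R by rewrite /= divfK// -normr_gt0.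
have G_le c n (w : Omega) : `|G c n w| <= `|h (set_val w)| / n.+1%:R.
  rewrite /= normrM mulrC normf_div normr_nat ler_wpM2l//.
  rewrite ler_pdivrMr// mulrC ler_pdivlMr// (le_trans _ (ltW (xP n)))//.
  by rewrite -natrM ler_nat mulnC leq_mul// leqW.
have G_inj : injective G.
  move=> c1 c2 G12; apply: contrapT => /eqP c12.
  (* Prescribe the values 1 at [c1] and 0 at [c2]. *)
  have [] := a_indep bool (fun b => if b then c1 else c2) (fun b : bool => b) 0.
    by move=> [] [] // /eqP; rewrite ?[c2 == _]eq_sym (negPf c12).
  move=> n _ an; have /eqP : G c1 n (x n) = G c2 n (x n) by rewrite G12.
  by rewrite !Gx (an true) (an false) eqr_nat.
exists (range G); first by apply: inj_card_eq => c1 c2 _ _; exact: G_inj.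
move=> N P z _ P0 Pcst z_inj zG.
have /boolp.choice[c cE] : forall i, exists c, G c = z i.
  by move=> i; have [c _ ?] := zG i; exists c.
have c_inj : injective c by move=> i j cij; apply: z_inj; rewrite -!cE cij.
set F := mmap _ _ _.
have FE n w : F n w = meval (fun i => G (c i) n w) P.
  by rewrite mmap_holo_seqE; apply: meval_eq => i; rewrite cE.
have Fu : ~ S_u Omega_open Omega_neq0 F.
  have [k Pk] := meval_nat_neq0 P0.
  move=> /S_uP /(_ `|meval (fun i => (k i)%:R) P|); rewrite normr_gt0.
  move=> /(_ Pk)[n0 _ Fn0].
  (* At this index the value of [F n] at [x n] is exactly the one whose modulus serves as the
     tolerance. *)
  have [n /Fn0/(_ (x n)) + ak] := a_indep _ c k n0 c_inj.
  rewrite FE (@meval_eq _ _ _ (fun i => (k i)%:R)) ?ltxx// => i.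
  by rewrite Gx ak.
split; last first.
  (* [F] is nonzero because the zero sequence converges uniformly. *)
  move=> F0; apply: Fu; rewrite F0; apply/S_uP => e e0.
  by apply: nearW => n w; rewrite normr0.
split=> //; apply: S_uc_locally_uniform => z0 e Oz e0.
have [d d0 Pd] := meval_small Pcst e0.
(* Near [z0] one has [|h| < |h z0| + 1], so for [n >= m] the bound [|h| / (n + 1)] on every [G c n]
   is below [d]. *)
have [m md] := norm_lt_nat ((`|h z0| + 1) / d).
have hz0 : \forall z' \near z0, `|h z'| < `|h z0| + 1.
  have /derivable1_diffP/differentiable_continuous h_cont := h_der z0 Oz.
  by apply: (cvgr_norm_lt _ h_cont); rewrite ltrDl.
exists ([set z' | `|h z'| < `|h z0| + 1], [set n | (m <= n)%N]).
  by split => //; exact: nbhs_infty_ge.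
move=> [z' n] [/= hz' mn] w wz'; rewrite FE; apply: Pd => i.
apply: le_lt_trans (G_le _ _ _) _; rewrite wz' ltr_pdivrMr//.
apply: (lt_trans hz'); rewrite mulrC -ltr_pdivrMr//.
apply: le_lt_trans (lt_le_trans md _); last by rewrite ler_nat leqW.
apply/real_ler_norm/ger0_real/divr_ge0; [exact: addr_ge0 | exact: ltW].
Qed.
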